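(* Let $F$ be a field and let $L$ be a Lie algebra over $F$ having a countable Hamel basis. Let $\mathcal{B}_1$ be a basis of $Z(L)$, extended by $\mathcal{B}_2=\{u_1,u_2,\dots\}$ to a basis $\mathcal{B}_1\cup\mathcal{B}_2$ of $L$. Let $x\in L'$ be such that for each choice of scalars $\{d_{i,j}\in F:i<j\}$ with $x=\sum_{1\le i<j\le r}d_{i,j}[u_i,u_j]$ (for some $r$), the associated weighted graph $\Gamma(D)$ contains a bad cycle with unfavorable proximity. Then $x\notin[L,L]$.
   Context: $Z(L)$ is the center of $L$, $L'$ is the derived subalgebra (the linear span of all brackets), and $[L,L]:=\{[a,b]: a,b\in L\}$ denotes the set of brackets (not its span). The graph $\Gamma(D)$ of an expression $x=\sum_{1\le i<j\le r}d_{i,j}[u_i,u_j]$: let $\mathcal{I}$ be the set of all indices that occur (as first or second index) in some pair with $d_{i,j}\neq0$. The function $D$ on pairs $i<j$ in $\mathcal{I}$ (a ''presentation'' of $x$) takes the value $\varepsilon$ (a formal symbol) if $[u_i,u_j]=0$ and $d_{i,j}$ if $[u_i,u_j]\neq0$. The weighted graph $\Gamma(D)$ has vertices $v_i$, $i\in\mathcal{I}$, and for $i<j$ in $\mathcal{I}$ with $[u_i,u_j]\neq0$ it has an edge between $v_i$ and $v_j$ with weight $d_{i,j}$ (possibly $0$). Isolated vertices are discarded. Bad cycle: a simple cycle $c_1\to c_2\to\cdots\to c_r\to c_1$ in a finite simple graph $\Gamma$ is bad if $\deg_\Gamma(c_i)>2$ for all $i\le r-2$ and $\deg_\Gamma(c_{r-1})=\deg_\Gamma(c_r)=2$.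 Proximity: given such a bad cycle $C_r$ (with $\deg_\Gamma(c_i)>2$ for $i\le r-2$ and $\deg_\Gamma(c_{r-1})=\deg_\Gamma(c_r)=2$) and, for each $1\le i\le r-2$, a vertex $c_{r+i}$ adjacent to $c_i$ and lying outside $C_r$, the subgraph consisting of $C_r$, the vertices $c_{r+i}$ and the edges between $c_i$ and $c_{r+i}$ is a proximity for $C_r$. It is unfavorable if the weights of the edges $c_1c_2,\,c_2c_3,\dots,c_{r-2}c_{r-1}$ and $c_1c_r$ are all $0$, while the weights of the edges $c_{r-1}c_r,\ c_1c_{r+1},\ c_2c_{r+2},\dots,c_{r-2}c_{2r-2}$ are all nonzero. *)

(* Defs.v *)
From HB Require Import structures.
From mathcomp Require Import all_boot all_order all_algebra.
From mathcomp Require Import boolp classical_sets functions cardinality.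

Set Implicit Arguments.
Unset Strict Implicit.
Unset Printing Implicit Defensive.

Import GRing.Theory.

Local Open Scope ring_scope.
Local Open Scope classical_set_scope.

HB.mixin Record isLieAlgebra (F : fieldType) L of GRing.Lmodule F L := {
  lie : L -> L -> L;
  lie_linearl : forall y, linear (fun x => lie x y);
  lie_linearr : forall x, linear (lie x);
  lie_alt : forall x, lie x x = 0;
  lie_jacobi : forall x y z,
    lie x (lie y z) + lie y (lie z x) + lie z (lie x y) = 0
}.

#[short(type="lieAlgType")]
HB.structure Definition LieAlgebra (F : fieldType) :=
  { L of isLieAlgebra F L & GRing.Lmodule F L }.

Section LinearAlgebra.
Variables (F : fieldType) (V : lmodType F).
Implicit Types (A U : set V).

Definition linspan A : set V :=
  [set v | exists (n : nat) (w : 'I_n -> V) (a : 'I_n -> F),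
     (forall i, A (w i)) /\ v = \sum_(i < n) a i *: w i].

Definition linfree A : Prop :=
  forall (n : nat) (w : 'I_n -> V) (a : 'I_n -> F),
    injective w -> (forall i, A (w i)) ->
    \sum_(i < n) a i *: w i = 0 -> forall i, a i = 0.

Definition hamel_basis U A : Prop :=
  [/\ A `<=` U, linfree A & U `<=` linspan A].

End LinearAlgebra.

Section LieSets.
Variables (F : fieldType) (L : lieAlgType F).

Definition lie_center : set L := [set z | forall y : L, lie z y = 0].

(* The set of brackets itself, not its span. *)
Definition lie_brackets : set L :=
  [set x | exists a b : L, x = lie a b].

Definition lie_derived : set L := linspan lie_brackets.

End LieSets.

(* A sequence u : nat -> V stands for a countable list u 0, u 1, ... which is
   infinite when N = None and has length n when N = Some n; the values of u
   beyond the length are irrelevant. [within N r] says that the first r terms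
   of the list exist. *)
Definition within (N : option nat) (r : nat) : bool :=
  if N is Some n then (r <= n)%N else true.

Definition list_index (N : option nat) : set nat := [set i | within N i.+1].

(* Finite simple graph with vertex set in an ambient finite type and weights on
   its edges; [weight] is only meaningful on edges. *)
Record wgraph (W : Type) (T : finType) := WGraph {
  vertices : {set T};
  edge : rel T;
  weight : T -> T -> W;
  edge_sym : symmetric edge;
  edge_irr : irreflexive edge;
  edge_vertices : forall v w, edge v w -> v \in vertices;
  weight_sym : forall v w, weight v w = weight w v
}.

Section Cycles.
Variables (F : fieldType) (T : finType) (G : wgraph F T).

Definition degree (v : T) : nat := #|[pred w | edge G v w]|.

(* The vertices c_1, c_2, ... are numbered from 1 by a function c on nat; an
   r-cycle only uses c 1, ..., c r. *)
Definition cycle_vertices (r : nat) (c : nat -> T) : seq T :=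
  [seq c i | i <- iota 1 r].

Definition simple_cycle (r : nat) (c : nat -> T) : Prop :=
  (3 <= r)%N /\ ucycle (edge G) (cycle_vertices r c).

Definition bad_cycle (r : nat) (c : nat -> T) : Prop :=
  [/\ simple_cycle r c,
      forall i, (1 <= i <= r - 2)%N -> (2 < degree (c i))%N,
      degree (c (r - 1)%N) = 2%N & degree (c r) = 2%N].

(* The outer vertices are c (r + 1), ..., c (r + (r - 2)); they need not be
   distinct. *)
Definition proximity (r : nat) (c : nat -> T) : Prop :=
  forall i, (1 <= i <= r - 2)%N ->
    edge G (c i) (c (r + i)%N) /\ c (r + i)%N \notin cycle_vertices r c.

Definition unfavorable (r : nat) (c : nat -> T) : Prop :=
  [/\ forall i, (1 <= i <= r - 2)%N -> weight G (c i) (c i.+1) = 0,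
      weight G (c 1%N) (c r) = 0,
      weight G (c (r - 1)%N) (c r) != 0 &
      forall i, (1 <= i <= r - 2)%N -> weight G (c i) (c (r + i)%N) != 0].

Definition has_bad_cycle_unfavorable : Prop :=
  exists (r : nat) (c : nat -> T),
    [/\ bad_cycle r c, proximity r c & unfavorable r c].

End Cycles.

Section GammaGraph.
Variables (F : fieldType) (L : lieAlgType F) (r : nat).
Variables (u : 'I_r -> L) (d : 'I_r -> 'I_r -> F).

(* Only the scalars d i j with i < j are ever used. *)
Definition lie_comb : L :=
  \sum_(i < r) \sum_(j < r | (i < j)%N) d i j *: lie (u i) (u j).

Definition occurring : {set 'I_r} :=
  [set i : 'I_r | [exists j : 'I_r, ((i < j)%N && (d i j != 0))
                          || ((j < i)%N && (d j i != 0))]]%SET.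

(* The formal symbol epsilon is None. *)
Definition presentation (i j : 'I_r) : option F :=
  if lie (u i) (u j) == 0 then None else Some (d i j).

(* The presentation read on unordered pairs of occurring indices. *)
Definition upresentation (i j : 'I_r) : option F :=
  if (i \in occurring) && (j \in occurring) then
    if (i < j)%N then presentation i j
    else if (j < i)%N then presentation j i
    else None
  else None.

Definition gamma_edge : rel 'I_r := fun i j => isSome (upresentation i j).

Definition gamma_weight (i j : 'I_r) : F := odflt 0 (upresentation i j).

(* Isolated vertices are discarded. *)
Definition gamma_vertices : {set 'I_r} :=
  [set i : 'I_r in occurring | [exists j, gamma_edge i j]]%SET.

Lemma upresentation_sym (i j : 'I_r) : upresentation i j = upresentation j i.
Proof. by rewrite /upresentation andbC; case: ltngtP. Qed.

Lemma gamma_edge_sym : symmetric gamma_edge.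
Proof. by move=> i j; rewrite /gamma_edge upresentation_sym. Qed.

Lemma gamma_edge_irr : irreflexive gamma_edge.
Proof. by move=> i; rewrite /gamma_edge /upresentation ltnn; case: ifP. Qed.

Lemma gamma_edge_vertices (i j : 'I_r) :
  gamma_edge i j -> i \in gamma_vertices.
Proof.
move=> ij; rewrite inE; apply/andP; split; last by apply/existsP; exists j.
by move: ij; rewrite /gamma_edge /upresentation; case: ifP => // /andP[].
Qed.

Lemma gamma_weight_sym (i j : 'I_r) : gamma_weight i j = gamma_weight j i.
Proof. by rewrite /gamma_weight upresentation_sym. Qed.

Definition gamma : wgraph F 'I_r :=
  WGraph gamma_edge_sym gamma_edge_irr gamma_edge_vertices gamma_weight_sym.

End GammaGraph.

(* Main.v *)
Require Import Defs.
From HB Require Import structures.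
From mathcomp Require Import all_boot all_order all_algebra.
From mathcomp Require Import boolp classical_sets functions cardinality.
From mathcomp Require Import ring zify.

(** Suppose that x = [a, b], and write a and b, modulo the centre, as
    combinations of the u_i with coefficients alpha_i and beta_i. Expanding the
    bracket gives x as a combination of the [u_i, u_j], i < j, whose
    coefficients are the 2x2 minors alpha_i beta_j - alpha_j beta_i, that is,
    the determinants of the plane vectors p_i = (alpha_i, beta_i)
    ([lie_comb_minor]). The hypothesis on x applies to this expression and
    provides a bad cycle c_1, ..., c_r with an unfavorable proximity.

    On an edge, weight 0 now means that the vectors at its two ends are
    parallel. The nonzero weights towards the outer vertices say that the
    vectors at c_1, ..., c_(r-2) are nonzero, and parallelism is transitive
    through a nonzero vector ([minor_trans]). Following the zero weights along
    the path c_r, c_1, c_2, ..., c_(r-1), the vectors at c_r and c_(r-1) are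
    parallel, so the edge joining these two vertices has weight 0, against
    unfavorability ([minor_gamma_favorable]). *)

Set Implicit Arguments.
Unset Strict Implicit.
Unset Printing Implicit Defensive.

Import GRing.Theory.

Local Open Scope ring_scope.
Local Open Scope classical_set_scope.

Section LieBilinearity.
Variables (F : fieldType) (L : lieAlgType F).
Implicit Types (x y z : L) (k : F).

Lemma lieDl x y z : lie (x + y) z = lie x z + lie y z.
Proof. by have := lie_linearl z 1 x y; rewrite !scale1r. Qed.

Lemma lieDr x y z : lie x (y + z) = lie x y + lie x z.
Proof. by have := lie_linearr x 1 y z; rewrite !scale1r. Qed.

Lemma lie0l z : lie 0 z = 0 :> L.
Proof. by apply: (addrI (lie 0 z)); rewrite -lieDl !addr0. Qed.

Lemma lie0r z : lie z 0 = 0 :> L.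
Proof. by apply: (addrI (lie z 0)); rewrite -lieDr !addr0. Qed.

Lemma lieZl k x z : lie (k *: x) z = k *: lie x z.
Proof. by have := lie_linearl z k x 0; rewrite /= !addr0 lie0l addr0. Qed.

Lemma lieZr k x z : lie x (k *: z) = k *: lie x z.
Proof. by have := lie_linearr x k z 0; rewrite /= !addr0 lie0r addr0. Qed.

Lemma lie_anti x y : lie y x = - lie x y.
Proof.
apply/eqP; rewrite -addr_eq0; apply/eqP.
by have := lie_alt (y + x); rewrite lieDl !lieDr !lie_alt add0r addr0.
Qed.

Lemma lie_suml (I : finType) (f : I -> L) z :
  lie (\sum_i f i) z = \sum_i lie (f i) z.
Proof.
exact: (big_morph (fun x => lie x z) (fun x y => lieDl x y z) (lie0l z)).
Qed.

Lemma lie_sumr (I : finType) (f : I -> L) z :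
  lie z (\sum_i f i) = \sum_i lie z (f i).
Proof. exact: (big_morph (lie z) (lieDr z) (lie0r z)). Qed.

Lemma lie_center_mod {z z'} x y :
  lie_center z -> lie_center z' -> lie (z + x) (z' + y) = lie x y.
Proof.
by move=> zC z'C; rewrite lieDl zC add0r lieDr lie_anti z'C oppr0 add0r.
Qed.

Lemma lie_center_comb {z z'} k : lie_center z -> lie_center z' ->
  lie_center (k *: z + z').
Proof. by move=> zC z'C y; rewrite lieDl lieZl zC z'C scaler0 addr0. Qed.

Lemma lie_center0 : lie_center (0 : L).
Proof. exact: lie0l. Qed.

End LieBilinearity.

Section Minors.
Variable F : fieldType.

(** The determinant of the plane vectors (al i, be i) and (al j, be j); it
    vanishes exactly when they are parallel. *)
Definition minor (I : Type) (al be : I -> F) (i j : I) : F :=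
  al i * be j - al j * be i.

Lemma minor_anti (I : Type) (al be : I -> F) i j :
  minor al be i j = - minor al be j i.
Proof. by rewrite /minor opprB. Qed.

(** Parallelism is transitive through a vector that is nonzero, which is
    witnessed here by a vector j' not parallel to it: the identity
    det(p_i, p_k) det(p_j, p_j') =
      det(p_i, p_j') det(p_j, p_k) + det(p_i, p_j) det(p_k, p_j')
    of plane vectors is the Plücker relation. *)
Lemma minor_trans (I : Type) (al be : I -> F) i j k j' :
    minor al be j j' != 0 ->
  minor al be i j = 0 -> minor al be j k = 0 -> minor al be i k = 0.
Proof.
move=> jj'N0 ij0 jk0; apply: (mulIf jj'N0); rewrite mul0r.
have -> : minor al be i k * minor al be j j' =
  minor al be i j' * minor al be j k + minor al be i j * minor al be k j'.
  by rewrite /minor; ring.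
by rewrite ij0 jk0 mulr0 mul0r addr0.
Qed.

End Minors.

Section BracketExpansion.
Variables (F : fieldType) (L : lieAlgType F).

(** Antisymmetry folds the terms with j < i of the bilinear expansion onto
    those with i < j. *)
Lemma lie_comb_minor (r : nat) (u : 'I_r -> L) (al be : 'I_r -> F) :
  lie (\sum_i al i *: u i) (\sum_i be i *: u i) = lie_comb u (minor al be).
Proof.
pose t i j := (al i * be j) *: lie (u i) (u j).
transitivity (\sum_i \sum_j t i j).
  rewrite lie_suml; apply: eq_bigr => i _.
  rewrite lie_sumr; apply: eq_bigr => j _.
  by rewrite lieZl lieZr scalerA.
transitivity (\sum_(i < r) \sum_(j < r | (i < j)%N) t i j +
              \sum_(i < r) \sum_(j < r | (j < i)%N) t i j).
  rewrite -big_split; apply: eq_bigr => i _ /=.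
  rewrite (bigID (fun j : 'I_r => (i < j)%N)) /=; congr (_ + _).
  rewrite (bigD1 i) ?ltnn //= {1}/t lie_alt scaler0 add0r.
  by apply: eq_bigl => j; rewrite -leqNgt ltn_neqAle andbC.
rewrite [X in _ + X](exchange_big_dep xpredT) //= -big_split /=.
apply: eq_bigr => i _; rewrite -big_split /=; apply: eq_bigr => j _.
by rewrite /t [lie (u j) _]lie_anti scalerN -scaleNr -scalerDl.
Qed.

(** The same coefficients serve for every large r, so that two vectors can be
    expanded over a common initial segment of the list. *)
Lemma linspan_center_expansion (B1 B2 : set L) (N : option nat)
    (u : nat -> L) :
  B1 `<=` @lie_center F L -> B2 = u @` list_index N ->
  forall v, linspan (B1 `|` B2) v ->
  exists (z : L) (al : nat -> F) (r0 : nat),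
    [/\ lie_center z, within N r0 &
        forall r, (r0 <= r)%N -> v = z + \sum_(i < r) al i *: u i].
Proof.
move=> B1C -> v [n [w [k [wB ->]]]].
apply: (big_ind (fun v => exists (z : L) (al : nat -> F) (r0 : nat),
    [/\ lie_center z, within N r0 &
        forall r, (r0 <= r)%N -> v = z + \sum_(i < r) al i *: u i])).
- exists 0, (fun=> 0), 0%N; split; [exact: lie_center0 | by case: N {wB} |].
  by move=> r _; rewrite add0r big1 // => i _; rewrite scale0r.
- move=> x y [z [al [r0 [zC r0N xE]]]] [z' [be [r1 [z'C r1N yE]]]].
  exists (z + z'), (fun i => al i + be i), (maxn r0 r1); split.
  + by rewrite -[z]scale1r; exact: lie_center_comb.
  + by case: N r0N r1N {wB} => //= m r0m r1m; rewrite geq_max r0m.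
  + move=> r; rewrite geq_max => /andP[/xE -> /yE ->].
    rewrite addrACA -big_split /=; congr (_ + _).
    by apply: eq_bigr => i _; rewrite scalerDl.
- move=> i _; case: (wB i) => [/B1C wC | [j jN <-]].
  + exists (k i *: w i), (fun=> 0), 0%N; split; last 1 first.
    * by move=> r _; rewrite big1 ?addr0 // => ? _; rewrite scale0r.
    * by rewrite -[_ *: _]addr0; apply: lie_center_comb wC _; exact: lie_center0.
    * by case: N {wB}.
  + exists 0, (fun m => if m == j then k i else 0), j.+1; split => //.
      exact: lie_center0.
    move=> r jr; rewrite add0r (bigD1 (Ordinal jr)) //= eqxx big1 ?addr0 //.
    by move=> m; rewrite -val_eqE /= => /negbTE ->; rewrite scale0r.
Qed.

End BracketExpansion.

Section CycleEdges.
Variables (F : fieldType) (T : finType) (G : wgraph F T).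
Variables (r : nat) (c : nat -> T).

Lemma simple_cycle_step i : simple_cycle G r c -> (1 <= i < r)%N ->
  edge G (c i) (c i.+1).
Proof.
move=> [r3 /andP[cycG _]] /andP[i1 ir]; move: cycG.
have -> : cycle_vertices r c = map c (1%N :: iota 2 r.-1).
  by rewrite /cycle_vertices; case: r r3.
rewrite /= -map_rcons path_map rcons_path => /andP[/(pathP 0%N)/(_ i.-1)].
rewrite size_iota -[_ :: _]/(iota 1 r.-1.+1) !nth_iota; [ | lia..].
have -> : (1 + i.-1)%N = i by lia.
have -> : (2 + i.-1)%N = i.+1 by lia.
by move=> /= stepE _; apply: stepE; lia.
Qed.

Lemma simple_cycle_close : simple_cycle G r c -> edge G (c r) (c 1%N).
Proof.
move=> [r3 /andP[+ _]]; have rE : r = r.-1.+1 by lia.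
rewrite /cycle_vertices [in iota _ _]rE /= rcons_path last_map.
rewrite -nth_last size_iota => /andP[_].
by rewrite nth_iota; [congr (edge G (c _) _) | ]; lia.
Qed.

End CycleEdges.

Section MinorWeights.
Variables (F : fieldType) (L : lieAlgType F) (n : nat).
Variables (u : 'I_n -> L) (al be : 'I_n -> F).
Local Notation G := (gamma u (minor al be)).

(** Weights are read on ordered pairs i < j, hence agree with the
    antisymmetric minors only up to sign. *)
Lemma gamma_weight_minor_eq0 i j : edge G i j ->
  (weight G i j == 0) = (minor al be i j == 0).
Proof.
rewrite /= /gamma_edge /gamma_weight /upresentation /presentation.
case: ifP => // _; case: ltngtP => // _; case: ifP => //= _ _.
by rewrite minor_anti oppr_eq0.
Qed.

(** The zero weights make all vectors on the path c_r, c_1, ..., c_(r-1)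
    parallel to the first one, and this contradicts the nonzero weight on the
    edge that closes it. *)
Lemma minor_gamma_favorable : ~ has_bad_cycle_unfavorable G.
Proof.
move=> [r [c [[cyc _ _ _] prox [path0 c1r0 /negP closeN0 outN0]]]].
have r3 : (3 <= r)%N by case: cyc.
have par_step i : (1 <= i <= r - 2)%N -> minor al be (c i) (c i.+1) = 0.
  move=> ir; have cE : edge G (c i) (c i.+1).
    by apply: simple_cycle_step cyc _; lia.
  by apply/eqP; rewrite -gamma_weight_minor_eq0 // path0.
have par_path i : (1 <= i <= r - 1)%N -> minor al be (c r) (c i) = 0.
  elim: i => // -[_ _ | i IHi ir].
    apply/eqP; rewrite -gamma_weight_minor_eq0 ?simple_cycle_close //.
    by rewrite weight_sym c1r0.
  have i1r : (1 <= i.+1 <= r - 2)%N by lia.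
  have [outE _] := prox _ i1r.
  apply: (@minor_trans _ _ _ _ _ (c i.+1) _ (c (r + i.+1)%N)).
  - by rewrite -gamma_weight_minor_eq0 // outN0.
  - by apply: IHi; lia.
  - exact: par_step.
apply: closeN0; rewrite gamma_weight_minor_eq0.
  by rewrite minor_anti par_path ?oppr0 //; lia.
have rE : r = (r - 1).+1 by lia.
by rewrite [in X in edge _ _ X]rE; apply: simple_cycle_step cyc _; lia.
Qed.

End MinorWeights.

Theorem theorem1p4 (F : fieldType) (L : lieAlgType F)
  (Lcountable : exists B : set L, countable B /\ hamel_basis setT B)
  (B1 B2 : set L)
  (B1_basis : hamel_basis (@lie_center F L) B1)
  (B12_disjoint : B1 `&` B2 = set0)
  (B12_basis : hamel_basis setT (B1 `|` B2))
  (N : option nat) (u : nat -> L)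
  (u_injective : forall i j, list_index N i -> list_index N j ->
     u i = u j -> i = j)
  (u_enum : B2 = u @` list_index N)
  (x : L) (x_derived : lie_derived x)
  (x_bad : forall (r : nat) (d : 'I_r -> 'I_r -> F),
     within N r -> x = lie_comb (fun i : 'I_r => u i) d ->
     has_bad_cycle_unfavorable (gamma (fun i : 'I_r => u i) d)) :
  ~ lie_brackets x.
Proof.
move=> [a [b xE]]; have [B1C _ _] := B1_basis; have [_ _ spanL] := B12_basis.
have expand v := @linspan_center_expansion _ _ _ _ _ _ B1C u_enum v (spanL v I).
have [z [al [ra [zC raN aE]]]] := expand a.
have [z' [be [rb [z'C rbN bE]]]] := expand b.
pose r := maxn ra rb.
have rN : within N r by rewrite /r; case: leqP.
apply: (@minor_gamma_favorable _ _ r (fun i => u i)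
          (fun i => al i) (fun i => be i)).
apply: x_bad => //.
rewrite xE (aE r) ?leq_maxl // (bE r) ?leq_maxr // lie_center_mod //.
exact: (lie_comb_minor (fun i : 'I_r => u i) (fun i => al i) (fun i => be i)).
Qed.
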